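(* Let $\mu$ be a complex number with $\Re(\mu)>0$. For the Seeley-de Witt coefficients $\tilde a_0[p,q],\tilde a_2[p,q],\tilde a_4[p,q]$ of the two-parametric family of Bianchi IX gravitational instantons, $$\tilde a_0[p,q](i\mu+1)=\tilde a_0[p,q+p+\tfrac12](i\mu),$$ $$\tilde a_2[p,q](i\mu+1)=\tilde a_2[p,q+p+\tfrac12](i\mu),$$ $$\tilde a_4[p,q](i\mu+1)=\tilde a_4[p,q+p+\tfrac12](i\mu).$$
   Context: General coefficients. Let $\sigma_1,\sigma_2,\sigma_3$ be the left-invariant 1-forms on $SU(2)\cong\mathbb S^3$ with $d\sigma_1=\sigma_2\wedge\sigma_3$ and cyclic permutations ($\int_{\mathbb S^3}|\sigma_1\wedge\sigma_2\wedge\sigma_3|=16\pi^2$). For functions $w_1,w_2,w_3,F$ of $\mu$ let $\tilde D$ be the Dirac operator (rank 4 spinors) of $d\tilde s^2 = F\left(w_1w_2w_3\,d\mu^2+\frac{w_2w_3}{w_1}\sigma_1^2+\frac{w_3w_1}{w_2}\sigma_2^2+\frac{w_1w_2}{w_3}\sigma_3^2\right)$, and consider $\mathrm{Trace}(\exp(-t\tilde D^2))\sim t^{-2}\sum_{n\ge0}\tilde a_{2n}t^n$, $t\to0^+$. Each coefficient is $\int(\cdot)\,d\mu$ of a function of $\mu$, obtained by integrating the local heat kernel coefficient of $\tilde D^2$ (times the volume density) over $\mathbb S^3$; this function of $\mu$ is again denoted $\tilde a_{2n}$, and it is a rational expression with rational coefficients in $w_1,w_2,w_3,F$ and their $\mu$-derivatives.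 Explicitly $\tilde a_0=4F^2w_1w_2w_3$ and $$\tilde a_2=-\tfrac F3(w_1^2+w_2^2+w_3^2)+\tfrac F6\Big(\tfrac{w_1^2w_2^2-w_3'^2}{w_3^2}+\tfrac{w_1^2w_3^2-w_2'^2}{w_2^2}+\tfrac{w_2^2w_3^2-w_1'^2}{w_1^2}\Big)-\tfrac F3\Big(\tfrac{w_1'w_2'}{w_1w_2}+\tfrac{w_1'w_3'}{w_1w_3}+\tfrac{w_2'w_3'}{w_2w_3}\Big)+\tfrac F3\Big(\tfrac{w_1''}{w_1}+\tfrac{w_2''}{w_2}+\tfrac{w_3''}{w_3}\Big)-\tfrac{F'^2}{2F}+F''.$$ Two-parametric family. For $p,q\in\mathbb C$, $\Re(\mu)>0$, put $\vartheta[p,q](i\mu)=\sum_{m\in\mathbb Z}\exp(-\pi(m+p)^2\mu+2\pi i(m+p)q)$, $\vartheta_2=\vartheta[\frac12,0]$, $\vartheta_3=\vartheta[0,0]$, $\vartheta_4=\vartheta[0,\frac12]$, and let $\partial_q\vartheta[a,b]$ denote the derivative in the second characteristic evaluated at $[a,b]$. Set (all theta functions at $i\mu$, $\Lambda$ a nonzero constant) $$w_1[p,q]=-\tfrac i2\vartheta_3\vartheta_4\frac{\partial_q\vartheta[p,q+\frac12]}{e^{\pi ip}\vartheta[p,q]},\quad w_2[p,q]=\tfrac i2\vartheta_2\vartheta_4\frac{\partial_q\vartheta[p+\frac12,q+\frac12]}{e^{\pi ip}\vartheta[p,q]},$$ $$w_3[p,q]=-\tfrac12\vartheta_2\vartheta_3\frac{\partial_q\vartheta[p+\frac12,q]}{\vartheta[p,q]},\quad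 F[p,q]=\frac{2}{\pi\Lambda}\left(\frac{\vartheta[p,q]}{\partial_q\vartheta[p,q]}\right)^2.$$ $\tilde a_{2n}[p,q](i\mu)$ is the function obtained by substituting $w_j=w_j[p,q]$, $F=F[p,q]$ in the expression for $\tilde a_{2n}$, continued to complex $\mu$ with $\Re(\mu)>0$; parameters and points where a denominator vanishes are excluded. All these are functions of the variable $i\mu$ in the upper half-plane; the value at $i\mu+1=i(\mu-i)$ is the value at time $\mu-i$. *)

(* Defs.v *)
From HB Require Import structures.
From mathcomp Require Import all_boot all_order all_algebra.
From mathcomp Require mpoly.

Set Implicit Arguments.
Unset Strict Implicit.
Unset Printing Implicit Defensive.

Import Order.TTheory GRing.Theory Num.Theory.
Local Open Scope ring_scope.

(* Module-local import: the notations of multinomials and of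
   mathcomp-analysis cannot be active in the same scope. *)
Module HeatCoefficient.

Import mpoly.

(* The symbols of the differential operators below, and of the parametrix, are
   polynomials in the following quantities.
   - Jet a k : the k-th mu-derivative of F (a = 0) or of w_a (a = 1, 2, 3);
   - Inv a   : the inverse of F (a = 0) or of w_a;
   - Coord j : coordinate y_j on S^3, cf. [left_field];
   - Dual a  : zeta_a = i xi_a, where xi is dual to (mu, y_1, y_2, y_3), so that
               zeta_a is the symbol of the partial derivative in direction a;
   - Res     : rho = (p_2 - lambda)^-1, with p_2 the principal symbol of D^2.
   The term r_n of the parametrix only involves jets of order at most n, and it
   is used for n <= 4. *)
Inductive generator :=
  | Jet of 'I_4 & 'I_5 | Inv of 'I_4 | Coord of 'I_3 | Dual of 'I_4 | Res.

Definition generator_code (g : generator) :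
    ('I_4 * 'I_5) + 'I_4 + 'I_3 + 'I_4 + unit :=
  match g with
  | Jet a k => inl (inl (inl (inl (a, k))))
  | Inv a => inl (inl (inl (inr a)))
  | Coord j => inl (inl (inr j))
  | Dual a => inl (inr a)
  | Res => inr tt
  end.

Definition generator_decode
    (c : ('I_4 * 'I_5) + 'I_4 + 'I_3 + 'I_4 + unit) : generator :=
  match c with
  | inl (inl (inl (inl (a, k)))) => Jet a k
  | inl (inl (inl (inr a))) => Inv a
  | inl (inl (inr j)) => Coord j
  | inl (inr a) => Dual a
  | inr tt => Res
  end.

Lemma generator_codeK : cancel generator_code generator_decode.
Proof. by case. Qed.

HB.instance Definition _ := Countable.copy generator (can_type generator_codeK).
HB.instance Definition _ : isFinite generator := CanIsFinite generator_codeK.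

Section Symbols.
Variable K : numClosedFieldType.

Definition symb := {mpoly K[#|{: generator}|]}.

Definition var (g : generator) : symb := 'X_(enum_rank g).
Definition jet (a : 'I_4) (k : nat) : symb := var (Jet a (inord k)).
Definition inv (a : 'I_4) : symb := var (Inv a).
Definition zeta (a : 'I_4) : symb := var (Dual a).
Definition y (j : 'I_3) : symb := var (Coord j).
Definition rho : symb := var Res.

(* 'I_4 indexes (mu, 1, 2, 3); the spatial index j : 'I_3 sits at sp j. *)
Definition sp (j : 'I_3) : 'I_4 := lift ord0 j.

(* Levi-Civita symbol *)
Definition eps (i j k : 'I_3) : K :=
  (i%:R - j%:R) * (j%:R - k%:R) * (k%:R - i%:R) / 2.

(* Pauli and gamma matrices; gamma_a gamma_b + gamma_b gamma_a = - 2 delta_ab. *)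
Definition pauli (j : 'I_3) : 'M[K]_2 :=
  match val j with
  | 0 => \matrix_(r, s) (r != s)%:R
  | 1 => \matrix_(r, s) if r == s then 0 else if r == 0 then - 'i else 'i
  | _ => \matrix_(r, s) if r == s then (-1) ^+ r else 0
  end.

Definition gamma (a : 'I_4) : 'M[symb]_4 :=
  map_mx (@mpolyC #|{: generator}| K)
    (match unlift ord0 a with
     | None => block_mx 0 ('i%:M : 'M[K]_2) 'i%:M 0
     | Some j => block_mx 0 (pauli j) (- pauli j) 0
     end : 'M[K]_(2 + 2)).

(* Symbol of the vector field X_j dual to sigma_j.  In the chart
   y = (q_1, q_2, q_3) / q_0 of the unit quaternions (y = 0 is the unit), the
   left-invariant field q e_j is the quadratic field e_j + y x e_j + y_j y, and
   X_j = - q e_j / 2: then [X_1, X_2] = - X_3 and cyclically, which is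
   d sigma_3 = sigma_1 /\ sigma_2. *)
Definition left_field (j : 'I_3) : symb :=
  - 2^-1 *: (zeta (sp j) +
    \sum_k (\sum_l eps k l j *: y l + y j * y k) * zeta (sp k)).

(* The metric is U^-1 (dmu^2 + sum_j sigma_j^2 / w_j^2), with
   U = 1 / (F w_1 w_2 w_3); E_a = (d/dmu, w_j X_j) is orthonormal for the
   metric in parentheses, and e_a = u E_a, where u^2 = U, for the metric. *)
Definition U : symb := \prod_a inv a.

Definition E (a : 'I_4) : symb :=
  match unlift ord0 a with
  | None => zeta ord0
  | Some j => jet (sp j) 0 * left_field j
  end.

(* E_a(u) / u = E_a(U) / (2 U) *)
Definition dlog_u (a : 'I_4) : symb :=
  if a == ord0 then - 2^-1 *: \sum_b jet b 1 * inv b else 0.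

Definition bracketE (a b c : 'I_4) : symb :=
  match unlift ord0 a, unlift ord0 b, unlift ord0 c with
  | Some i, Some j, Some k =>
      - eps i j k *: (jet (sp i) 0 * jet (sp j) 0 * inv (sp k))
  | None, Some j, Some k => if j == k then jet (sp j) 1 * inv (sp j) else 0
  | Some i, None, Some k => if i == k then - (jet (sp i) 1 * inv (sp i)) else 0
  | _, _, _ => 0
  end.

(* u^-1 <[e_a, e_b], e_c>; the square root u drops out. *)
Definition bracket (a b c : 'I_4) : symb :=
  bracketE a b c + (b == c)%:R * dlog_u a - (a == c)%:R * dlog_u b.

(* u^-1 <nabla_(e_a) e_b, e_c>, by Koszul's formula *)
Definition connection (a b c : 'I_4) : symb :=
  2^-1 *: (bracket a b c - bracket b c a + bracket c a b).

(* The Dirac operator is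
     D = sum_a gamma_a (e_a + 1/4 sum_(b,c) <nabla_(e_a) e_b, e_c> gamma_b gamma_c)
       = u B,
   and B has symbol b1 + b0. *)
Definition b1 : 'M[symb]_4 := \sum_a E a *: gamma a.
Definition b0 : 'M[symb]_4 :=
  \sum_a \sum_b \sum_c
    (4^-1 *: connection a b c) *: (gamma a *m gamma b *m gamma c).

(* Derivations of symb.  In direction i of (mu, y_1, y_2, y_3) or in zeta_i they
   are prescribed on the generators other than Res, and the one of
   rho = (p_2 - lambda)^-1 is - rho^2 times the one of p_2.  The derivative of
   the jets of maximal order is never used and is set to 0. *)
Definition x_gen (i : 'I_4) (g : generator) : symb :=
  match g with
  | Jet a k => if (i == ord0) && (k < 4)%N then jet a k.+1 else 0
  | Inv a => if i == ord0 then - (jet a 1 * inv a ^+ 2) else 0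
  | Coord j => (i == sp j)%:R
  | Dual _ | Res => 0
  end.

Definition zeta_gen (i : 'I_4) (g : generator) : symb :=
  if g is Dual a then (i == a)%:R else 0.

Definition derivation (d : generator -> symb) (f : symb) : symb :=
  \sum_g d g * f^`M(enum_rank g).

(* The principal symbol of D^2 is the scalar matrix p2s%:M. *)
Definition p2s : symb := - (U * \sum_a E a ^+ 2).

Definition symb_der (d : generator -> symb) (f : symb) : symb :=
  derivation d f - rho ^+ 2 * derivation d p2s * f^`M(enum_rank Res).

Definition dx (i : 'I_4) : symb -> symb := symb_der (x_gen i).
Definition dzeta (i : 'I_4) : symb -> symb := symb_der (zeta_gen i).

(* sum over |alpha| = m of (1 / alpha!) (d_zeta^alpha f) (d_x^alpha g): the
   order m term of the symbol of a composition.  As zeta = i xi, d_zeta d_x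
   equals d_xi D_x with D_x = - i d_x. *)
Fixpoint leibniz (m : nat) (f g : 'M[symb]_4) : 'M[symb]_4 :=
  if m is m'.+1 then
    (m%:R^-1)%:MP *:
      \sum_i leibniz m' (map_mx (dzeta i) f) (map_mx (dx i) g)
  else f *m g.

(* D^2 = u B u B = U B^2 + (U' / 2) gamma_0 B; its symbol is p2 + p1 + p0. *)
Definition half_dU : symb := 2^-1 *: dx ord0 U.

Definition p2 : 'M[symb]_4 := U *: (b1 *m b1).
Definition p1 : 'M[symb]_4 :=
  U *: (b1 *m b0 + b0 *m b1 + leibniz 1 b1 b1)
  + half_dU *: (gamma ord0 *m b1).
Definition p0 : 'M[symb]_4 :=
  U *: (b0 *m b0 + leibniz 1 b1 b0) + half_dU *: (gamma ord0 *m b0).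

(* Symbol r_0 + r_1 + ... of the parametrix of D^2 - lambda:
     r_0 = rho,
     r_n = - sum (1 / alpha!) (d_xi^alpha r_j) (D_x^alpha p_k) r_0,
   over j < n and n = j + |alpha| + 2 - k. *)
Definition parametrix_next (s : seq 'M[symb]_4) : 'M[symb]_4 :=
  let n := size s in
  - (rho *: \sum_(j < n)
      (leibniz (n - j) s`_j p2 + leibniz (n - j).-1 s`_j p1
       + (if (2 <= n - j)%N then leibniz (n - j).-2 s`_j p0 else 0))).

Fixpoint parametrix_seq (n : nat) : seq 'M[symb]_4 :=
  if n is n'.+1 then
    let s := parametrix_seq n' in rcons s (parametrix_next s)
  else [:: rho%:M].

Definition parametrix (n : nat) : 'M[symb]_4 := (parametrix_seq n)`_n.

(* The local heat kernel coefficient is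
     (2 pi)^-4 int_(R^4) (1 / 2 pi i) int_C e^(-lambda) tr r_n dlambda dxi,
   C being a contour around the half-line [0, +oo[.  The lambda-integral turns
   rho^k into e^(-p_2) / (k - 1)!.  At y = 0 the principal symbol is
   p_2 = sum_a G_a xi_a^2, so that the xi-integral of e^(-p_2) times a monomial in
   zeta = i xi is pi^2 / sqrt (prod_a G_a) times a product of moments, where
   zeta_a^e has moment (e - 1)!! (- 1 / (2 G_a))^(e / 2) for e even. *)
Definition moment (G : K) (e : nat) : K :=
  if odd e then 0
  else (\prod_(i < e./2) (i.*2.+1)%:R) * (- (2 * G)^-1) ^+ e./2.

(* J a k : value of the k-th derivative of F (a = 0) or of w_a *)
Variable J : 'I_4 -> nat -> K.

Definition inverse_metric (a : 'I_4) : K :=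
  (\prod_b (J b 0)^-1) * (if a == ord0 then 1 else J a 0 ^+ 2 / 4).

Definition gen_value (g : generator) (e : nat) : K :=
  match g with
  | Jet a k => J a k ^+ e
  | Inv a => (J a 0)^-1 ^+ e
  | Coord _ => 0 ^+ e
  | Dual a => moment (inverse_metric a) e
  | Res => if e is k.+1 then (k`!%:R)^-1 else 0
  end.

Definition integrate (f : symb) : K :=
  \sum_(m <- msupp f) f@_m * \prod_g gen_value g (m (enum_rank g)).

(* Function of mu obtained by integrating over S^3.  The metric being
   left-invariant, the density is a constant multiple of
   |sigma_1 /\ sigma_2 /\ sigma_3|, which is 8 |dy| at y = 0.  The constants
   collect into
     16 pi^2 / 8 * (2 pi)^-4 * pi^2 / sqrt (prod_a G_a) = F^2 w_1 w_2 w_3. *)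
Definition heat_coefficient (n : nat) : K :=
  J ord0 0 ^+ 2 * (\prod_j J (sp j) 0) * integrate (\tr (parametrix n)).

End Symbols.

End HeatCoefficient.

Section SeeleyDeWitt.
Variables (K : numClosedFieldType) (J : 'I_4 -> nat -> K).

Let F k := J (inord 0) k.
Let w1 k := J (inord 1) k.
Let w2 k := J (inord 2) k.
Let w3 k := J (inord 3) k.

Definition a0 : K := 4 * F 0 ^+ 2 * w1 0 * w2 0 * w3 0.

Definition a2 : K :=
  - (F 0 / 3) * (w1 0 ^+ 2 + w2 0 ^+ 2 + w3 0 ^+ 2)
  + F 0 / 6 * ((w1 0 ^+ 2 * w2 0 ^+ 2 - w3 1 ^+ 2) / w3 0 ^+ 2
             + (w1 0 ^+ 2 * w3 0 ^+ 2 - w2 1 ^+ 2) / w2 0 ^+ 2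
             + (w2 0 ^+ 2 * w3 0 ^+ 2 - w1 1 ^+ 2) / w1 0 ^+ 2)
  - F 0 / 3 * (w1 1 * w2 1 / (w1 0 * w2 0) + w1 1 * w3 1 / (w1 0 * w3 0)
             + w2 1 * w3 1 / (w2 0 * w3 0))
  + F 0 / 3 * (w1 2 / w1 0 + w2 2 / w2 0 + w3 2 / w3 0)
  - F 1 ^+ 2 / (2 * F 0) + F 2.

Definition a4 : K := HeatCoefficient.heat_coefficient J 4.

End SeeleyDeWitt.

From mathcomp Require Import all_classical all_reals all_analysis.
From mathcomp Require Import complex.
Import numFieldNormedType.Exports.
Local Open Scope classical_set_scope.
Local Open Scope complex_scope.

Section TwoParametricFamily.
Variable R : realType.
Let C : numClosedFieldType := R[i].

Definition iC : C := 0 +i* 1.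
Definition piC : C := pi%:C.

Definition cexp (z : C) : C :=
  (expR (complex.Re z))%:C * (cos (complex.Im z) +i* sin (complex.Im z)).

(* theta p q mu is the value of vartheta[p,q] at i mu; the sum over Z is the
   limit of the sums over - N <= m <= N. *)
Definition theta_term (p q mu : C) (m : int) : C :=
  cexp (- piC * (m%:~R + p) ^+ 2 * mu + 2 * piC * iC * (m%:~R + p) * q).

Definition theta (p q mu : C) : C :=
  lim ((fun N : nat =>
    \sum_(k < N.*2.+1) theta_term p q mu (k%:Z - N%:Z)) @ \oo).

Definition dtheta (p q mu : C) : C := derive1 (fun q' => theta p q' mu) q.

Definition theta2 : C -> C := theta (1 / 2) 0.
Definition theta3 : C -> C := theta 0 0.
Definition theta4 : C -> C := theta 0 (1 / 2).

Definition w1 (p q mu : C) : C :=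
  - (iC / 2) * theta3 mu * theta4 mu
  * (dtheta p (q + 1 / 2) mu / (cexp (piC * iC * p) * theta p q mu)).

Definition w2 (p q mu : C) : C :=
  iC / 2 * theta2 mu * theta4 mu
  * (dtheta (p + 1 / 2) (q + 1 / 2) mu / (cexp (piC * iC * p) * theta p q mu)).

Definition w3 (p q mu : C) : C :=
  - (1 / 2) * theta2 mu * theta3 mu
  * (dtheta (p + 1 / 2) q mu / theta p q mu).

Definition F (Lambda p q mu : C) : C :=
  2 / (piC * Lambda) * (theta p q mu / dtheta p q mu) ^+ 2.

Definition family_jet (Lambda p q mu : C) (a : 'I_4) (k : nat) : C :=
  derive1n k
    (match val a with
     | 0 => F Lambda p q | 1 => w1 p q | 2 => w2 p q | _ => w3 p q
     end) mu.

Definition tilde_a0 (Lambda p q mu : C) : C := a0 (family_jet Lambda p q mu).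
Definition tilde_a2 (Lambda p q mu : C) : C := a2 (family_jet Lambda p q mu).
Definition tilde_a4 (Lambda p q mu : C) : C := a4 (family_jet Lambda p q mu).

End TwoParametricFamily.

(* Main.v *)
(* Completing the square in (m + p)^2, and m^2 = m mod 2, give
     vartheta[p,q](i mu + 1) = exp (- pi i (p^2 + p)) vartheta[p,q+p+1/2](i mu),
   so that (F, w_1, w_2, w_3)[p,q] at i mu + 1 is (F, w_1, w_3, w_2)[p,q+p+1/2]
   at i mu.  The coefficients are symmetric in w_2 and w_3.  For
   a_0 and a_2 this is read off the formulas; for the heat coefficients it
   holds because minus the exchange of the axes 2 and 3 is a rotation of R^3, so
   that sigma_1 -> - sigma_1, sigma_2 -> - sigma_3, sigma_3 -> - sigma_2 is
   induced by an automorphism of SU(2).  It acts on the symbols by signs and a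
   permutation of the variables, and the symbols of D^2 and of its parametrix
   are invariant up to conjugation by a lift to the spin group. *)
Require Import Defs.
From HB Require Import structures.
From mathcomp Require Import all_boot all_order all_algebra.
From mathcomp Require Import ring.
From mathcomp Require bigenough ssrcomplements mpoly.

Set Implicit Arguments.
Unset Strict Implicit.
Unset Printing Implicit Defensive.

Import Order.TTheory GRing.Theory Num.Theory.
Local Open Scope ring_scope.

Module HeatCoefficientSymmetry.

Import bigenough.BigEnough ssrcomplements mpoly HeatCoefficient.

(** * Exchange of the axes 2 and 3 *)

(* j |-> - j modulo 3 exchanges the axes 2 and 3, which are 1 and 2 in 'I_3. *)
Definition flip3 (j : 'I_3) : 'I_3 := - j.

Definition flip4 (a : 'I_4) : 'I_4 := oapp (sp \o flip3) ord0 (unlift ord0 a).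

Definition rot_gen (g : generator) : generator :=
  match g with
  | Jet a k => Jet (flip4 a) k
  | Inv a => Inv (flip4 a)
  | Coord j => Coord (flip3 j)
  | Dual a => Dual (flip4 a)
  | Res => Res
  end.

Lemma flip3K : involutive flip3.
Proof. exact: opprK. Qed.

Lemma flip4_0 : flip4 ord0 = ord0.
Proof. by rewrite /flip4 unlift_none. Qed.

Lemma flip4_sp j : flip4 (sp j) = sp (flip3 j).
Proof. by rewrite /flip4 /sp liftK. Qed.

Lemma flip4K : involutive flip4.
Proof.
move=> a; case: (unliftP ord0 a) => [j|] ->; last by rewrite !flip4_0.
by rewrite -/(sp j) !flip4_sp flip3K.
Qed.

Lemma flip4_eq a b : (flip4 a == flip4 b) = (a == b).
Proof. exact: (inj_eq (inv_inj flip4K)). Qed.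

Lemma flip4_eq0 a : (flip4 a == ord0) = (a == ord0).
Proof. by rewrite -{1}flip4_0 flip4_eq. Qed.

Lemma rot_genK : involutive rot_gen.
Proof. by case=> [a k|a|j|a|] /=; rewrite ?flip4K ?flip3K. Qed.

Lemma flip3E (j : 'I_3) :
  flip3 j = (match val j with 0 => 0 | 1 => 2 | _ => 1 end)%N :> nat.
Proof. by case: j => [[|[|[|]]]]. Qed.

Lemma flip4E (a : 'I_4) :
  flip4 a = (match a : nat with 2 => 3 | 3 => 2 | n => n end)%N :> nat.
Proof.
case: (unliftP ord0 a) => [j|] ->; last by rewrite flip4_0.
by rewrite -/(sp j) flip4_sp /sp !lift0 flip3E; case: j => [[|[|[|]]]].
Qed.

Lemma flip4_inord n m : (n < 4)%N ->
  match n with 2 => 3 | 3 => 2 | k => k end = m :> nat ->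
  flip4 (inord n) = inord m.
Proof.
by move=> n4 <-; apply: val_inj; rewrite /= flip4E (inordK n4) inordK;
  case: n n4 => [|[|[|[|]]]].
Qed.

(** * The rotation as an endomorphism of the symbol algebra *)

Section Rotation.
Variable K : numClosedFieldType.
Local Notation symb := (symb K).

Definition sgn4 (a : 'I_4) : K := if a == ord0 then 1 else -1.

(** The rotation is minus the exchange of axes, so coordinates and spatial covectors change sign.
    The jets of [F] and [w_j] are only permuted, since the metric is quadratic in the [sigma_j]. *)
Definition rot_sgn (g : generator) : K :=
  match g with
  | Coord _ => -1
  | Dual a => sgn4 a
  | _ => 1
  end.

Definition rot_var (i : 'I_#|{: generator}|) : symb :=
  rot_sgn (enum_val i) *: var K (rot_gen (enum_val i)).

Definition rot : symb -> symb := mmap (@mpolyC #|{: generator}| K) rot_var.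

HB.instance Definition _ := GRing.RMorphism.copy rot
  (mmap (@mpolyC #|{: generator}| K) rot_var).

Lemma rotC c : rot c%:MP = c%:MP.
Proof. exact: mmapC. Qed.

Lemma rot_scalable : scalable rot.
Proof. by move=> c f; rewrite -!mul_mpolyC rmorphM /= rotC. Qed.

HB.instance Definition _ := GRing.isScalable.Build K symb symb *:%R rot
  rot_scalable.

Lemma rotZ c f : rot (c *: f) = c *: rot f.
Proof. exact: linearZ. Qed.

Lemma rotX g : rot (var K g) = rot_sgn g *: var K (rot_gen g).
Proof. by rewrite /rot /var mmapX mmap1U /rot_var enum_rankK. Qed.

Lemma sgn4_0 : sgn4 ord0 = 1. Proof. by []. Qed.
Lemma sgn4_sp j : sgn4 (sp j) = -1. Proof. by []. Qed.

Lemma sgn4_flip a : sgn4 (flip4 a) = sgn4 a.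
Proof. by rewrite /sgn4 flip4_eq0. Qed.

Lemma sgn4_sqr a : sgn4 a * sgn4 a = 1.
Proof. by rewrite /sgn4; case: ifP; rewrite ?mulrNN ?mulr1. Qed.

(** Symbols form the algebra generated by constants and variables; identities between derivations
    can thus be checked on generators. *)
Lemma symb_ind (P : symb -> Prop) :
  (forall c, P c%:MP) -> (forall g, P (var K g)) ->
  (forall f g, P f -> P g -> P (f + g)) ->
  (forall f g, P f -> P g -> P (f * g)) -> forall f, P f.
Proof.
move=> PC PX PD PM; elim/mpolyind => [|c m p _ _ IH]; first exact: (PC 0).
apply: (PD) => //; rewrite -mul_mpolyC; apply: (PM) => //.
rewrite mpolyXE_id; apply: (big_ind P) => [||i _]; [exact: (PC 1)|exact: (PM)|].
elim: (m i) => [|k IHk]; first by rewrite expr0; exact: (PC 1).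
by rewrite exprS; apply: PM => //; rewrite -(enum_valK i); exact: PX.
Qed.

(** * Derivations of the symbol algebra *)

Section Derivation.
Variable d : generator -> symb.

Lemma derivation_linear : linear (derivation d).
Proof.
move=> c f g; rewrite /derivation scaler_sumr -big_split /=.
by apply: eq_bigr => h _; rewrite mderivD mderivZ mulrDr scalerAr.
Qed.

HB.instance Definition _ := GRing.isLinear.Build K symb symb *:%R
  (derivation d) derivation_linear.

Lemma derivationC c : derivation d c%:MP = 0.
Proof. by rewrite /derivation big1 // => g _; rewrite mderivC mulr0. Qed.

Lemma derivationM f g :
  derivation d (f * g) = derivation d f * g + f * derivation d g.
Proof.
rewrite /derivation mulr_suml mulr_sumr -big_split /=.
by apply: eq_bigr => h _; rewrite mderivM mulrDr !mulrA (mulrC f).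
Qed.

Lemma derivationX g : derivation d (var K g) = d g.
Proof.
rewrite /derivation (bigD1 g) //= big1 => [|h hg]; rewrite /var mderivX mnm1E.
  rewrite eqxx scale1r addr0 (_ : (_ - _)%MM = 0%MM) ?mpolyX0 ?mulr1 //.
  by apply/mnmP => i; rewrite mnmBE mnm0E subnn.
by rewrite (inj_eq enum_rank_inj) eq_sym (negPf hg) scale0r mulr0.
Qed.

End Derivation.

(** Both sides obey the same Leibniz rule along [rot], so agreement on generators suffices. *)
Lemma rot_derivation (d1 d2 : generator -> symb) (c : K) :
  (forall g, rot (d1 g) = c *: (rot_sgn g *: d2 (rot_gen g))) ->
  forall f, rot (derivation d1 f) = c *: derivation d2 (rot f).
Proof.
move=> d12; elim/symb_ind => [a|g|f g IHf IHg|f g IHf IHg].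
- by rewrite rotC !derivationC rmorph0 scaler0.
- by rewrite rotX linearZ /= !derivationX d12.
- by rewrite !linearD /= IHf IHg.
- rewrite derivationM rmorphD !rmorphM /= IHf IHg derivationM.
  by rewrite scalerDr scalerAl scalerAr.
Qed.

(** Absorbs the correction term into the value prescribed at [Res], which makes [rot_derivation]
    applicable. *)
Lemma symb_derE (d : generator -> symb) f : d Res = 0 ->
  symb_der d f =
  derivation (fun g => if g == Res then - (rho K ^+ 2 * derivation d (p2s K))
                       else d g) f.
Proof.
move=> dR; rewrite /symb_der {1 3}/derivation (bigD1 Res) //= dR mul0r add0r.
rewrite [RHS](bigD1 Res) //= addrC mulNr; congr (_ + _).
by apply: eq_bigr => g /negPf ->.
Qed.

(** * Action on the frame, the connection and the principal symbol *)

Lemma rotJ a k : rot (jet K a k) = jet K (flip4 a) k.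
Proof. by rewrite /jet rotX scale1r. Qed.

Lemma rotI a : rot (inv K a) = inv K (flip4 a).
Proof. by rewrite /inv rotX scale1r. Qed.

Lemma rotY j : rot (y K j) = - y K (flip3 j).
Proof. by rewrite /y rotX /= scaleN1r. Qed.

Lemma rotzeta a : rot (zeta K a) = sgn4 a *: zeta K (flip4 a).
Proof. by rewrite /zeta rotX. Qed.

Lemma rotrho : rot (rho K) = rho K.
Proof. by rewrite /rho rotX scale1r. Qed.

(** The exchange of two axes is an odd permutation. *)
Lemma eps_flip i j k : eps K (flip3 i) (flip3 j) (flip3 k) = - eps K i j k.
Proof.
rewrite /eps !flip3E; case: i j k => [[|[|[|i]]] //= _] [[|[|[|j]]] //= _]
  [[|[|[|k]]] //= _]; ring.
Qed.

Lemma rot_left_field j : rot (left_field K j) = - left_field K (flip3 j).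
Proof.
rewrite /left_field linearZ /= -scalerN opprD rmorphD /= rotzeta flip4_sp.
rewrite sgn4_sp scaleN1r; congr (_ *: (_ + _)).
rewrite rmorph_sum (reindex_inj (inv_inj flip3K)) -sumrN /=.
apply: eq_bigr => k _; rewrite rmorphM /= rotzeta flip4_sp flip3K sgn4_sp.
rewrite scaleN1r mulrN; congr (- (_ * _)).
(* The two signs of the quadratic term cancel; in the cross product, the sign of [y] cancels that of
   [eps]. *)
rewrite rmorphD rmorphM /= !rotY flip3K mulrNN rmorph_sum; congr (_ + _).
rewrite (reindex_inj (inv_inj flip3K)); apply: eq_bigr => l _.
by rewrite /= rotZ rotY flip3K scalerN -scaleNr -{1}(flip3K j) eps_flip opprK.
Qed.

Lemma rotU : rot (U K) = U K.
Proof.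
rewrite /U rmorph_prod (reindex_inj (inv_inj flip4K)).
by apply: eq_bigr => a _; rewrite /= rotI flip4K.
Qed.

Lemma rotE a : rot (E K a) = sgn4 a *: E K (flip4 a).
Proof.
rewrite /E; case: (unliftP ord0 a) => [j|] ->; last first.
  by rewrite rotzeta flip4_0 unlift_none.
rewrite -/(sp j) flip4_sp /sp liftK -/(sp _) rmorphM /= rotJ flip4_sp.
by rewrite rot_left_field sgn4_sp scaleN1r mulrN.
Qed.

Lemma sum_flip4 (V : nmodType) (f : 'I_4 -> V) :
  \sum_a f (flip4 a) = \sum_a f a.
Proof. by rewrite [RHS](reindex_inj (inv_inj flip4K)). Qed.

Lemma rot_p2s : rot (p2s K) = p2s K.
Proof.
rewrite /p2s rmorphN rmorphM /= rotU rmorph_sum -[in RHS]sum_flip4.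
congr (- (_ * _)); apply: eq_bigr => a _.
by rewrite rmorphXn /= rotE exprZn expr2 sgn4_sqr scale1r.
Qed.

Lemma rot_dlog_u a : rot (dlog_u K a) = dlog_u K a.
Proof.
rewrite /dlog_u; case: ifP; last by rewrite rmorph0.
rewrite rotZ rmorph_sum -[in RHS]sum_flip4 /= => _; congr (_ *: _).
by apply: eq_bigr => b _; rewrite rmorphM /= rotJ rotI.
Qed.

(** [u] depends on [mu] only, and the [mu] direction is fixed with sign 1. *)
Lemma dlog_u_flip a : sgn4 a *: dlog_u K (flip4 a) = dlog_u K a.
Proof.
by rewrite /dlog_u flip4_eq0 /sgn4; case: ifP; rewrite ?scaler0 ?scale1r.
Qed.

(** For three spatial indices, the product of signs is -1, as for [eps]; in the terms with one index
    [ord0], the two spatial signs cancel. *)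
Lemma rot_bracketE a b c : rot (bracketE K a b c) =
  (sgn4 a * sgn4 b * sgn4 c) *: bracketE K (flip4 a) (flip4 b) (flip4 c).
Proof.
rewrite /bracketE.
case: (unliftP ord0 a) => [i|] ->; case: (unliftP ord0 b) => [j|] ->;
  case: (unliftP ord0 c) => [k|] ->;
  rewrite -?/(sp _) ?flip4_sp ?flip4_0 ?unlift_none /sp ?liftK -?/(sp _);
  rewrite ?rmorph0 ?scaler0 ?sgn4_sp ?sgn4_0 //.
- rewrite rotZ !rmorphM /= !rotJ rotI !flip4_sp eps_flip scalerA.
  by congr (_ *: _); ring.
- rewrite (inj_eq (inv_inj flip3K)); case: ifP; rewrite ?rmorph0 ?scaler0 //.
  rewrite rmorphN rmorphM /= rotJ rotI flip4_sp => _.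
  by rewrite mulr1 mulrNN mulr1 scale1r.
- rewrite (inj_eq (inv_inj flip3K)); case: ifP; rewrite ?rmorph0 ?scaler0 //.
  rewrite rmorphM /= rotJ rotI flip4_sp => _.
  by rewrite mul1r mulrNN mulr1 scale1r.
Qed.

Lemma rot_bracket a b c : rot (bracket K a b c) =
  (sgn4 a * sgn4 b * sgn4 c) *: bracket K (flip4 a) (flip4 b) (flip4 c).
Proof.
rewrite /bracket rmorphB rmorphD /= rot_bracketE scalerBr scalerDr !flip4_eq.
congr (_ + _ - _); rewrite rmorphM /= rmorph_nat rot_dlog_u.
  case: eqP => [->|_]; last by rewrite !mul0r scaler0.
  by rewrite -mulrA sgn4_sqr mulr1 !mul1r dlog_u_flip.
case: eqP => [->|_]; last by rewrite !mul0r scaler0.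
by rewrite mulrAC sgn4_sqr !mul1r dlog_u_flip.
Qed.

Lemma rot_connection a b c : rot (connection K a b c) =
  (sgn4 a * sgn4 b * sgn4 c) *: connection K (flip4 a) (flip4 b) (flip4 c).
Proof.
rewrite /connection linearZ rmorphD rmorphB /= !rot_bracket.
rewrite [RHS]scalerA [_ * 2^-1]mulrC -[RHS]scalerA; congr (_ *: _).
have -> : sgn4 b * sgn4 c * sgn4 a = sgn4 a * sgn4 b * sgn4 c by ring.
have -> : sgn4 c * sgn4 a * sgn4 b = sgn4 a * sgn4 b * sgn4 c by ring.
by rewrite -scalerBr -scalerDr.
Qed.

(** * Equivariance of the derivatives in position and covector *)

Lemma rot_x_gen i g :
  rot (x_gen K i g) = sgn4 i *: (rot_sgn g *: x_gen K (flip4 i) (rot_gen g)).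
Proof.
rewrite scalerA; case: g => [a k|a|j|a|] /=; rewrite ?flip4_eq0;
  try by rewrite rmorph0 scaler0.
- rewrite mulr1 /sgn4; case: (i == ord0) => /=; last by rewrite rmorph0 scaler0.
  by case: ifP => _; rewrite ?rmorph0 ?scaler0 // rotJ scale1r.
- rewrite mulr1 /sgn4; case: (i == ord0) => /=; last by rewrite rmorph0 scaler0.
  by rewrite rmorphN rmorphM rmorphXn /= rotJ rotI scale1r.
- rewrite rmorph_nat -flip4_sp flip4_eq; case: eqP => [->|_].
    by rewrite sgn4_sp mulrNN mulr1 scale1r.
  by rewrite scaler0.
Qed.

Lemma rot_zeta_gen i g : rot (zeta_gen K i g) =
  sgn4 i *: (rot_sgn g *: zeta_gen K (flip4 i) (rot_gen g)).
Proof.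
rewrite scalerA; case: g => [a k|a|j|a|] /=; try by rewrite rmorph0 scaler0.
rewrite rmorph_nat flip4_eq; case: eqP => [->|_]; last by rewrite scaler0.
by rewrite sgn4_sqr scale1r.
Qed.

Lemma rot_symb_der (d1 d2 : generator -> symb) (c : K) :
  d1 Res = 0 -> d2 Res = 0 ->
  (forall g, rot (d1 g) = c *: (rot_sgn g *: d2 (rot_gen g))) ->
  forall f, rot (symb_der d1 f) = c *: symb_der d2 (rot f).
Proof.
move=> d1R d2R d12 f; rewrite !symb_derE //.
(* [rot_gen] fixes [Res], so both conditionals take the same branch; at [Res] the values match
   because [rho] and [p2s] are invariant. *)
apply: rot_derivation => g; rewrite -(inj_eq (inv_inj rot_genK) g).
case: ifP => [/eqP/(inv_inj rot_genK) -> /=|_]; last exact: d12.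
rewrite scale1r rmorphN rmorphM rmorphXn /= rotrho (rot_derivation d12) rot_p2s.
by rewrite scalerN scalerAr.
Qed.

Lemma rot_dx i f : rot (dx i f) = sgn4 i *: dx (flip4 i) (rot f).
Proof. by apply: rot_symb_der => //; exact: rot_x_gen. Qed.

Lemma rot_dzeta i f : rot (dzeta i f) = sgn4 i *: dzeta (flip4 i) (rot f).
Proof. by apply: rot_symb_der => //; exact: rot_zeta_gen. Qed.

Lemma symb_der_linear d : linear (@symb_der K d).
Proof.
move=> c f g; rewrite /symb_der linearP mderivD mderivZ /=.
by rewrite mulrDr -scalerAr scalerBr opprD addrACA.
Qed.

HB.instance Definition _ i := GRing.isLinear.Build K symb symb *:%R
  (@dx K i) (symb_der_linear (x_gen K i)).
HB.instance Definition _ i := GRing.isLinear.Build K symb symb *:%R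
  (@dzeta K i) (symb_der_linear (zeta_gen K i)).

(** * Constant matrices in the composition of symbols *)

Definition const_symb (s : 'M[K]_4) : 'M[symb]_4 :=
  map_mx (@mpolyC #|{: generator}| K) s.

Lemma const_symbM s1 s2 :
  const_symb (s1 *m s2) = const_symb s1 *m const_symb s2.
Proof. exact: map_mxM. Qed.

Lemma const_symb_scalar c : const_symb c%:M = c%:MP%:M.
Proof. exact: map_scalar_mx. Qed.

Lemma map_mx_constl (D : {linear symb -> symb}) s (A : 'M_4) :
  map_mx D (const_symb s *m A) = const_symb s *m map_mx D A.
Proof.
apply/matrixP => i j; rewrite !mxE raddf_sum; apply: eq_bigr => k _ /=.
by rewrite !mxE !mul_mpolyC linearZ.
Qed.

Lemma map_mx_constr (D : {linear symb -> symb}) s (A : 'M_4) :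
  map_mx D (A *m const_symb s) = map_mx D A *m const_symb s.
Proof.
apply/matrixP => i j; rewrite !mxE raddf_sum; apply: eq_bigr => k _ /=.
by rewrite !mxE ![_ * _%:MP]mulrC !mul_mpolyC linearZ.
Qed.

Lemma leibniz_constl m s f g :
  leibniz m (const_symb s *m f) g = const_symb s *m leibniz m f g.
Proof.
elim: m f g => [|m IHm] f g /=; first by rewrite mulmxA.
rewrite -scalemxAr mulmx_sumr; congr (_ *: _); apply: eq_bigr => i _.
by rewrite map_mx_constl IHm.
Qed.

Lemma leibniz_constr m s f g :
  leibniz m f (g *m const_symb s) = leibniz m f g *m const_symb s.
Proof.
elim: m f g => [|m IHm] f g /=; first by rewrite mulmxA.
rewrite -scalemxAl mulmx_suml; congr (_ *: _); apply: eq_bigr => i _.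
by rewrite map_mx_constr IHm.
Qed.

(** The derivatives are [K]-linear, so a constant matrix crosses from one factor to the other at
    every order. *)
Lemma leibniz_const m s f g :
  leibniz m (f *m const_symb s) g = leibniz m f (const_symb s *m g).
Proof.
elim: m f g => [|m IHm] f g /=; first by rewrite mulmxA.
congr (_ *: _); apply: eq_bigr => i _.
by rewrite map_mx_constr map_mx_constl IHm.
Qed.

Lemma map_rot_const s : map_mx rot (const_symb s) = const_symb s.
Proof. by apply/matrixP => i j; rewrite !mxE rotC. Qed.

(** Each summand pairs [dzeta i] with [dx i]: the sign [sgn4 i] occurs twice, and the sum is
    reindexed by [flip4]. *)
Lemma rot_leibniz m f g :
  map_mx rot (leibniz m f g) = leibniz m (map_mx rot f) (map_mx rot g).
Proof.
elim: m f g => [|m IHm] f g /=; first by rewrite map_mxM.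
rewrite map_mxZ /= rotC; congr (_ *: _).
rewrite raddf_sum -[RHS]sum_flip4; apply: eq_bigr => i _ /=; rewrite IHm.
(* The signs are written as constant scalar matrices, so that [leibniz_const] brings them
   together. *)
have -> : map_mx rot (map_mx (dzeta i) f) =
    map_mx (dzeta (flip4 i)) (map_mx rot f) *m const_symb (sgn4 i)%:M.
  apply/matrixP => r s; rewrite const_symb_scalar mul_mx_scalar !mxE.
  by rewrite rot_dzeta mul_mpolyC.
have -> : map_mx rot (map_mx (dx i) g) =
    const_symb (sgn4 i)%:M *m map_mx (dx (flip4 i)) (map_mx rot g).
  apply/matrixP => r s; rewrite const_symb_scalar mul_scalar_mx !mxE.
  by rewrite rot_dx mul_mpolyC.
rewrite leibniz_const mulmxA -const_symbM -scalar_mxM sgn4_sqr.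
by rewrite const_symb_scalar mul1mx.
Qed.

(** * Lift of the rotation to spinors *)

Definition spin2 : 'M[K]_2 := pauli K 1 - pauli K (-1).

(** Conjugation by the Pauli matrix of a vector is, up to scale, the half-turn about it; the one
    about [e_2 - e_3] sends each [e_j] to minus its exchange. *)
Lemma spin2_pauli j : spin2 *m pauli K j = - (pauli K (flip3 j) *m spin2).
Proof.
have i2 : 'i * 'i = -1 :> K by rewrite -expr2 sqrCi.
apply/matrixP => r s; rewrite !mxE !big_ord_recl !big_ord0 /= !mxE /pauli.
rewrite [val (flip3 j)]flip3E.
by case: j => [[|[|[|]]] //= ?]; case: r => [[|[|]] //= ?];
  case: s => [[|[|]] //= ?]; rewrite !mxE /=; ring: i2.
Qed.

(** 2 is the squared length of [e_2 - e_3]; leaving the lift unnormalised avoids a square root. *)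
Lemma spin2_sqr : spin2 *m spin2 = 2%:M.
Proof.
have i2 : 'i * 'i = -1 :> K by rewrite -expr2 sqrCi.
apply/matrixP => r s; rewrite !mxE !big_ord_recl !big_ord0 /= !mxE /pauli.
by case: r => [[|[|]] //= ?]; case: s => [[|[|]] //= ?];
  rewrite ?mxE /=; ring: i2.
Qed.

(* The rotation is the half-turn about e_2 - e_3, which lifts to
   sigma_2 - sigma_3 (Pauli matrices) up to a factor. *)
Definition spin4 : 'M[K]_(2 + 2) := block_mx spin2 0 0 spin2.

(** [gamma] before its entries become constant symbols, so that it can be computed with by blocks
    over [K]. *)
Definition dirac (a : 'I_4) : 'M[K]_(2 + 2) :=
  if unlift ord0 a is Some j then block_mx 0 (pauli K j) (- pauli K j) 0
  else block_mx 0 'i%:M 'i%:M 0.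

Lemma spin4_sqr : spin4 *m spin4 = 2%:M.
Proof.
rewrite mulmx_block !mulmx0 !mul0mx !addr0 !add0r spin2_sqr.
by rewrite -scalar_mx_block.
Qed.

Lemma spin4_dirac a : spin4 *m dirac a = sgn4 a *: (dirac (flip4 a) *m spin4).
Proof.
rewrite /dirac; case: (unliftP ord0 a) => [j|] ->; last first.
  rewrite flip4_0 unlift_none scale1r !mulmx_block.
  by rewrite !mulmx0 !mul0mx !addr0 !add0r scalar_mxC.
rewrite -/(sp j) flip4_sp /sp liftK -/(sp j) sgn4_sp scaleN1r !mulmx_block.
rewrite !mulmx0 !mul0mx !addr0 !add0r opp_block_mx oppr0.
by rewrite mulmxN spin2_pauli mulNmx !opprK.
Qed.

Lemma gammaE a : gamma K a = const_symb (dirac a).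
Proof. by rewrite /gamma /dirac; case: unlift. Qed.

Definition spin : 'M[symb]_4 := const_symb spin4.

Lemma spin_sqr : spin *m spin = 2%:M.
Proof.
rewrite -const_symbM [X in const_symb X]spin4_sqr.
by rewrite const_symb_scalar rmorph_nat.
Qed.

Lemma spin_gamma a :
  spin *m gamma K a = (sgn4 a)%:MP *: (gamma K (flip4 a) *m spin).
Proof.
rewrite !gammaE -!const_symbM -mul_scalar_mx -const_symb_scalar -const_symbM.
by rewrite mul_scalar_mx [X in const_symb X]spin4_dirac.
Qed.

(** * Covariance of the symbol of [D^2] and of its parametrix *)

Lemma rot_gamma a : map_mx rot (gamma K a) = gamma K a.
Proof. by rewrite gammaE map_rot_const. Qed.

(** Invariance up to conjugation by [spin], in an inverse-free form stable under sums and
    products. *)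
Definition covariant (A : 'M[symb]_4) := map_mx rot A *m spin = spin *m A.

Lemma covariant0 : covariant 0.
Proof. by rewrite /covariant map_mx0 mul0mx mulmx0. Qed.

Lemma covariantD A B : covariant A -> covariant B -> covariant (A + B).
Proof.
by rewrite /covariant map_mxD mulmxDl mulmxDr => -> ->.
Qed.

Lemma covariantN A : covariant A -> covariant (- A).
Proof. by rewrite /covariant map_mxN mulNmx mulmxN => ->. Qed.

Lemma covariantZ c A : rot c = c -> covariant A -> covariant (c *: A).
Proof.
by rewrite /covariant map_mxZ /= -scalemxAl -scalemxAr => -> ->.
Qed.

Lemma covariantM A B : covariant A -> covariant B -> covariant (A *m B).
Proof.
by rewrite /covariant map_mxM -mulmxA => eA ->; rewrite !mulmxA eA.
Qed.

Lemma covariant_sum (I : finType) (A : I -> 'M[symb]_4) :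
  (forall i, covariant (A i)) -> covariant (\sum_i A i).
Proof.
move=> cA; apply: (big_ind covariant covariant0 covariantD) => i _.
exact: cA.
Qed.

(** Being constant, [spin] travels from the right of [g], between the factors, to the left of
    [f]. *)
Lemma covariant_leibniz m f g :
  covariant f -> covariant g -> covariant (leibniz m f g).
Proof.
rewrite /covariant => ef eg.
by rewrite rot_leibniz -leibniz_constr eg -leibniz_const ef leibniz_constl.
Qed.

Lemma covariant_gamma0 : covariant (gamma K ord0).
Proof.
by rewrite /covariant rot_gamma spin_gamma flip4_0 sgn4_0 scale1r.
Qed.

(** The signs produced by [rot] on the frame are those produced by [spin] on the gamma matrices. *)
Lemma covariant_b1 : covariant (b1 K).
Proof.
rewrite /covariant /b1 raddf_sum mulmx_suml mulmx_sumr -[LHS]sum_flip4.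
apply: eq_bigr => a _ /=; rewrite map_mxZ /= rotE flip4K sgn4_flip rot_gamma.
rewrite -scalemxAr spin_gamma -scalemxAl !scalerA.
by rewrite -mul_mpolyC [_ * E K a]mulrC.
Qed.

Lemma spin_gamma3 a b c :
  spin *m (gamma K a *m gamma K b *m gamma K c) =
  (sgn4 a * sgn4 b * sgn4 c)%:MP *:
    (gamma K (flip4 a) *m gamma K (flip4 b) *m gamma K (flip4 c) *m spin).
Proof.
rewrite !mulmxA spin_gamma -!scalemxAl -[_ *m spin *m _]mulmxA spin_gamma.
rewrite -!scalemxAr -scalemxAl -!mulmxA spin_gamma -!scalemxAr !scalerA.
by rewrite !rmorphM.
Qed.

(** The same matching, with [rot_connection] against [spin_gamma3]. *)
Lemma covariant_b0 : covariant (b0 K).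
Proof.
rewrite /covariant /b0.
rewrite raddf_sum mulmx_suml mulmx_sumr -[LHS]sum_flip4; apply: eq_bigr => a _.
rewrite raddf_sum mulmx_suml mulmx_sumr -[LHS]sum_flip4; apply: eq_bigr => b _.
rewrite raddf_sum mulmx_suml mulmx_sumr -[LHS]sum_flip4; apply: eq_bigr => c _.
rewrite /= map_mxZ /= rotZ rot_connection !flip4K !sgn4_flip !map_mxM /=.
rewrite !rot_gamma -scalemxAr spin_gamma3 -!scalemxAl !scalerA.
congr (_ *: _).
by rewrite -!mul_mpolyC; ring.
Qed.

Lemma rot_half_dU : rot (half_dU K) = half_dU K.
Proof.
by rewrite /half_dU rotZ rot_dx flip4_0 sgn4_0 scale1r rotU.
Qed.

Lemma covariant_p2 : covariant (p2 K).
Proof.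
by apply: (covariantZ rotU); apply: covariantM; exact: covariant_b1.
Qed.

Lemma covariant_p1 : covariant (p1 K).
Proof.
have [cb1 cb0] := (covariant_b1, covariant_b0).
apply: covariantD; last first.
  by apply: (covariantZ rot_half_dU); exact: (covariantM covariant_gamma0).
apply: (covariantZ rotU); apply: covariantD; last exact: covariant_leibniz.
by apply: covariantD; exact: covariantM.
Qed.

Lemma covariant_p0 : covariant (p0 K).
Proof.
have [cb1 cb0] := (covariant_b1, covariant_b0).
apply: covariantD; last first.
  by apply: (covariantZ rot_half_dU); exact: (covariantM covariant_gamma0).
apply: (covariantZ rotU).
by apply: covariantD; [exact: covariantM|exact: covariant_leibniz].
Qed.

Lemma covariant_parametrix_next s :
  (forall j, covariant s`_j) -> covariant (parametrix_next s).
Proof.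
move=> cs; apply: covariantN; apply: (covariantZ rotrho).
apply: covariant_sum => j; apply: covariantD; last first.
  case: ifP => _; last exact: covariant0.
  exact: (covariant_leibniz _ (cs j) covariant_p0).
by apply: covariantD; [exact: (covariant_leibniz _ (cs j) covariant_p2)|
  exact: (covariant_leibniz _ (cs j) covariant_p1)].
Qed.

(** Past the end of the sequence the entry is the default 0, which is covariant; hence [j] ranges
    freely, as the recursion step requires. *)
Lemma covariant_parametrix_seq n j : covariant (parametrix_seq K n)`_j.
Proof.
elim: n j => [|n IHn] j /=.
  case: j => [|j] /=; last by rewrite nth_nil; exact: covariant0.
  by rewrite /covariant map_scalar_mx /= rotrho scalar_mxC.
rewrite nth_rcons; case: ifP => _; first exact: IHn.
case: ifP => _; last exact: covariant0.
exact: covariant_parametrix_next.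
Qed.

(** The trace is invariant under conjugation. With [spin *m spin = 2%:M] in place of an inverse, the
    equality is obtained after doubling. *)
Lemma rot_trace A : covariant A -> rot (\tr A) = \tr A.
Proof.
move=> cA; have n2 : (2 : symb) != 0.
  by rewrite -(mpolyC_nat _ K) mpolyC_eq0 pnatr_eq0.
apply: (mulIf n2); rewrite -trace_map_mx.
rewrite mulrC -[in LHS]mxtraceZ -mul_mx_scalar -spin_sqr mulmxA cA.
by rewrite mxtrace_mulC mulmxA spin_sqr mul_scalar_mx mxtraceZ mulrC.
Qed.

(** * Integration of symbols and symmetry of the coefficients *)

Lemma gen_value_flip (J : 'I_4 -> nat -> K) g e :
  gen_value (J \o flip4) g e = rot_sgn g ^+ e * gen_value J (rot_gen g) e.
Proof.
have inverse_metric_flip a :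
    inverse_metric (J \o flip4) a = inverse_metric J (flip4 a).
  rewrite /inverse_metric flip4_eq0; congr (_ * _).
  by rewrite [RHS](reindex_inj (inv_inj flip4K)).
case: g => [a k|a|j|a|] /=; rewrite ?expr1n ?mul1r //.
  (* Positive powers of a coordinate vanish at [y = 0], which hides the sign. *)
  by case: e => [|e]; rewrite ?expr0 ?mulr1 // expr0n mulr0.
(* Odd moments vanish, and an even power kills the sign. *)
rewrite inverse_metric_flip /moment; case: ifP => [|e_even].
  by rewrite mulr0.
by rewrite -(odd_double_half e) e_even add0n -mul2n exprM expr2 sgn4_sqr
  expr1n mul1r.
Qed.

Definition rot_mnm (m : 'X_{1..#|{: generator}|}) : 'X_{1..#|{: generator}|} :=
  [multinom m (enum_rank (rot_gen (enum_val i))) | i < #|{: generator}|].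

Lemma rotXm m : rot 'X_[m] =
  (\prod_g rot_sgn g ^+ m (enum_rank g)) *: 'X_[rot_mnm m].
Proof.
pose r (i : 'I_#|{: generator}|) := enum_rank (rot_gen (enum_val i)).
have rK : involutive r by move=> i; rewrite /r enum_rankK rot_genK enum_valK.
rewrite /rot mmapX /mmap1 mpolyXE_id [in RHS](reindex_inj (inv_inj rK)) /=.
rewrite [in RHS](reindex_onto enum_val enum_rank) /=; last first.
  by move=> g _; rewrite enum_rankK.
under [in RHS]eq_bigl => i do rewrite enum_valK eqxx.
rewrite -scaler_prod; apply: eq_bigr => i _.
by rewrite exprZn enum_valK /rot_mnm mnmE -/(r (r i)) rK.
Qed.

(** Replaces the support, which varies with [f], by all monomials below a common degree bound, so
    that linearity is termwise. *)
Lemma integrateE (J : 'I_4 -> nat -> K) f i : (msize f <= i)%N ->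
  integrate J f =
  \sum_(m : 'X_{1..#|{: generator}| < i})
    f@_m * \prod_g gen_value J g (m (enum_rank g)).
Proof.
move=> le_fi; set I : subFinType _ := 'X_{1..#|{: generator}| < i}.
rewrite /integrate (big_mksub I) ?msupp_uniq //=; first last.
  by move=> x /msize_mdeg_lt /leq_trans; apply.
by rewrite big_rmcond //= => j /memN_msupp_eq0 ->; rewrite mul0r.
Qed.

Lemma integrate_linear (J : 'I_4 -> nat -> K) : linear_for *%R (integrate J).
Proof.
move=> c f g; pose_big_enough i; first rewrite !(@integrateE J _ i) //.
  rewrite mulr_sumr -big_split /=; apply: eq_bigr => m _.
  by rewrite mcoeffD mcoeffZ mulrDl mulrA.
by close.
Qed.

HB.instance Definition _ J := GRing.isLinear.Build K symb K *%R
  (@integrate K J) (integrate_linear J).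

Lemma integrateX (J : 'I_4 -> nat -> K) m :
  integrate J 'X_[m] = \prod_g gen_value J g (m (enum_rank g)).
Proof. by rewrite /integrate msuppX big_seq1 mcoeffX eqxx mul1r. Qed.

(** By linearity only monomials matter, and for them [gen_value_flip] compares the two products
    factor by factor. *)
Lemma integrate_flip (J : 'I_4 -> nat -> K) f :
  integrate (J \o flip4) f = integrate J (rot f).
Proof.
elim/mpolyind: f => [|c m f _ _ IHf]; first by rewrite !raddf0.
rewrite rmorphD /= rotZ !linearP /= IHf rotXm linearZ /= !integrateX.
congr (_ * _ + _).
rewrite [X in _ = _ * X](reindex_inj (inv_inj rot_genK)) -big_split.
by apply: eq_bigr => g _; rewrite gen_value_flip mnmE enum_rankK rot_genK.
Qed.

Lemma heat_coefficient_flip (J : 'I_4 -> nat -> K) n :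
  heat_coefficient (J \o flip4) n = heat_coefficient J n.
Proof.
rewrite /heat_coefficient integrate_flip rot_trace; last first.
  exact: covariant_parametrix_seq.
rewrite /= flip4_0; congr (_ * _ * _).
rewrite [RHS](reindex_inj (inv_inj flip3K)).
by apply: eq_bigr => j _; rewrite flip4_sp.
Qed.

Lemma a2_flip (J : 'I_4 -> nat -> K) : a2 (J \o flip4) = a2 J.
Proof.
rewrite /a2 /= (@flip4_inord 0 0) // (@flip4_inord 1 1) //
  (@flip4_inord 2 3) // (@flip4_inord 3 2) // !invfM; ring.
Qed.

Lemma a0_flip (J : 'I_4 -> nat -> K) : a0 (J \o flip4) = a0 J.
Proof.
rewrite /a0 /= (@flip4_inord 0 0) // (@flip4_inord 1 1) //
  (@flip4_inord 2 3) // (@flip4_inord 3 2) //; ring.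
Qed.

End Rotation.
End HeatCoefficientSymmetry.

From mathcomp Require Import all_classical all_reals all_analysis.
From mathcomp Require Import complex.

Import numFieldNormedType.Exports.
Local Open Scope classical_set_scope.
Local Open Scope complex_scope.

(* No convergence is needed: the limit is the junk value 0 when it diverges. *)
Lemma lim_scale (K : numClosedFieldType) (T : Type) (G : set_system T)
  (FG : ProperFilter G) (c : K) (f : T -> K) : c != 0 ->
  lim (c * f x @[x --> G]) = c * lim (f x @[x --> G]).
Proof.
move=> c0; have [fl|fl] := pselect (cvg (f x @[x --> G])).
  apply: cvg_lim => //; apply: cvgM; [exact: cvg_cst|exact: fl].
have cfl : ~ cvg (c * f x @[x --> G]).
  move=> H; apply: fl.
  by rewrite -(is_cvgZlE f c0).
by rewrite (dvgP fl) (dvgP cfl) mulr0.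
Qed.

Lemma eq_lim (K : numClosedFieldType) (T : Type) (G : set_system T)
  (f g : T -> K) : f =1 g -> lim (f x @[x --> G]) = lim (g x @[x --> G]).
Proof. by move=> /funext ->. Qed.

(** * Modular behaviour of the theta functions *)

Section Shifts.
Variable R : realType.
Let C : numClosedFieldType := R[i].
Implicit Types (p q mu c s : C) (f : C -> C).

Lemma derive1_scale c f q : c != 0 ->
  derive1 (fun x => c * f x) q = c * derive1 f q.
Proof.
move=> c0; rewrite /derive1 -lim_scale //.
by apply: eq_lim => h; rewrite -mulrBr /GRing.scale /= mulrCA.
Qed.

Lemma eq_derive1 f g q : f =1 g -> derive1 f q = derive1 g q.
Proof. by move=> /funext ->. Qed.

Lemma derive1_shift s f q : derive1 (fun x => f (x + s)) q = derive1 f (q + s).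
Proof.
rewrite /derive1.
by apply: eq_lim => h; rewrite addrA.
Qed.

Lemma derive1n_shift s k f q :
  derive1n k (fun x => f (x + s)) q = derive1n k f (q + s).
Proof.
elim: k q => [//|k IHk] q; rewrite !derive1nS -(derive1_shift s).
exact: (eq_derive1 _ IHk).
Qed.

Lemma eq_derive1n k f g q : f =1 g -> derive1n k f q = derive1n k g q.
Proof. by move=> /funext ->. Qed.

(** * The complex exponential and the character [expi] *)

Lemma cexpD (a b : C) : cexp (a + b) = cexp a * cexp b.
Proof.
case: a b => [a1 a2] [b1 b2]; rewrite /cexp /= expRD cosD sinD.
apply/eqP; rewrite eq_complex; apply/andP; split; apply/eqP; simpc => /=; ring.
Qed.

Lemma cexp0 : cexp (0 : C) = 1.
Proof. by rewrite /cexp /= expR0 cos0 sin0 mul1r. Qed.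

Lemma cexp_neq0 (a : C) : cexp a != 0.
Proof.
apply/eqP => a0; have := cexpD a (- a); rewrite subrr cexp0 a0 mul0r.
by move/eqP; rewrite oner_eq0.
Qed.

(** All multipliers below are values of this character, so relations between them reduce to
    relations between arguments. *)
Definition expi (x : C) : C := cexp (piC R * iC R * x).

Lemma expiD x y : expi (x + y) = expi x * expi y.
Proof. by rewrite /expi mulrDr cexpD. Qed.

Lemma expi_neq0 x : expi x != 0.
Proof. exact: cexp_neq0. Qed.

Lemma expi0 : expi 0 = 1.
Proof. by rewrite /expi mulr0 cexp0. Qed.

Lemma expi_half : expi (1 / 2) = iC R.
Proof.
have e : piC R * iC R * (1 / 2) = 0 +i* (pi / 2) :> C.
  have -> : (1 / 2 : C) = (2^-1)%:C by rewrite mul1r fmorphV rmorph_nat.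
  rewrite /piC /iC; simpc.
  by [].
by rewrite /expi e /cexp /= expR0 cos_pihalf sin_pihalf mul1r.
Qed.

Lemma expi1 : expi 1 = -1.
Proof.
have e : (1 : C) = 1 / 2 + 1 / 2 by field.
by rewrite [in LHS]e expiD expi_half /iC; simpc.
Qed.

Lemma expi_nat n : expi n%:R = (-1) ^+ n.
Proof.
elim: n => [|n IHn]; first by rewrite expi0.
by rewrite -addn1 natrD expiD IHn expi1 exprD.
Qed.

Lemma expi_intr (m : int) : expi m%:~R = (-1) ^+ `|m|%N.
Proof.
case: m => n; first exact: expi_nat.
apply: (mulIf (expi_neq0 n.+1%:R)); rewrite -expiD NegzE mulrNz addNr expi0.
by rewrite expi_nat -expr2 sqrr_sign.
Qed.

(** A square has the parity of its root. *)
Lemma expi_sqr_int (m : int) : expi (m%:~R ^+ 2) = expi m%:~R.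
Proof.
rewrite -rmorphXn /= !expi_intr abszX -signr_odd oddX /=.
by rewrite signr_odd.
Qed.

Lemma expi_int2 (m : int) : expi (2 * m%:~R) = 1.
Proof. by rewrite mulr_natl mulr2n expiD expi_intr -expr2 sqrr_sign. Qed.

(** * Theta functions at [mu - i] *)

Definition shift_factor (p : C) : C := expi (- (p ^+ 2 + p)).

Lemma theta_term_modular p q mu (m : int) :
  theta_term p q (mu - iC R) m =
  shift_factor p * theta_term p (q + p + 1 / 2) mu m.
Proof.
set n : C := m%:~R.
have E (a b : C) : theta_term p a b m =
    cexp (- piC R * (n + p) ^+ 2 * b) * expi (2 * (n + p) * a).
  by rewrite /theta_term cexpD; congr (_ * cexp _); ring.
rewrite !E.
have -> : - piC R * (n + p) ^+ 2 * (mu - iC R) =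
  - piC R * (n + p) ^+ 2 * mu + piC R * iC R * (n + p) ^+ 2 by ring.
rewrite cexpD -/(expi _) -[LHS]mulrA [RHS]mulrCA; congr (_ * _).
(* Once [n ^+ 2] is replaced by [n], the exponent is affine in [n], and its linear part is absorbed
   by the new second characteristic. *)
rewrite sqrrD !expiD expi_sqr_int -!expiD -/n; congr (expi _).
by field.
Qed.

Lemma theta_scale c p a b q q' : c != 0 ->
  (forall m, theta_term p q a m = c * theta_term p q' b m) ->
  theta p q a = c * theta p q' b.
Proof.
move=> c0 e; rewrite /theta -(lim_scale _ _ c0).
apply: eq_lim => N; rewrite mulr_sumr; apply: eq_bigr => k _; exact: e.
Qed.

Lemma theta_modular p q mu :
  theta p q (mu - iC R) = shift_factor p * theta p (q + p + 1 / 2) mu.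
Proof.
by apply: theta_scale => [|m]; [exact: expi_neq0|exact: theta_term_modular].
Qed.

Lemma theta_period p q mu : theta p (q + 1) mu = expi (2 * p) * theta p q mu.
Proof.
apply: theta_scale => [|m]; first exact: expi_neq0.
have -> : expi (2 * p) = expi (2 * (m%:~R + p)) :> C.
  by rewrite [in RHS]mulrDr [in RHS]expiD expi_int2 mul1r.
by rewrite -cexpD /theta_term; congr cexp; ring.
Qed.

(** The multiplier of [theta_modular] does not depend on [q], so it passes through the derivative in
    [q]. *)
Lemma dtheta_modular p q mu :
  dtheta p q (mu - iC R) = shift_factor p * dtheta p (q + p + 1 / 2) mu.
Proof.
transitivity
  (derive1 (fun x => shift_factor p * theta p (x + (p + 1 / 2)) mu) q).
  by apply: eq_derive1 => x; rewrite theta_modular addrA.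
rewrite (derive1_scale _ _ (expi_neq0 _)).
by rewrite (derive1_shift (p + 1 / 2) (fun x => theta p x mu)) addrA.
Qed.

Lemma dtheta_period p q mu : dtheta p (q + 1) mu = expi (2 * p) * dtheta p q mu.
Proof.
rewrite /dtheta -(derive1_shift 1 (fun x => theta p x mu)).
rewrite -(derive1_scale _ _ (expi_neq0 _)).
by apply: eq_derive1 => x; rewrite theta_period.
Qed.

Lemma theta2_modular mu : theta2 (mu - iC R) = expi (1 / 4) * theta2 mu.
Proof.
rewrite /theta2 theta_modular -addrA -mulrDl -[1 + 1]/(2%:R).
rewrite divff ?pnatr_eq0 //.
(* The second characteristic has become 1; returning it to 0 adds 1 to the argument -3/4 of the
   shift factor, whence 1/4. *)
rewrite theta_period mulrA -expiD; congr (expi _ * _).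
by field.
Qed.

Lemma theta3_modular mu : theta3 (mu - iC R) = theta4 mu.
Proof.
rewrite /theta3 theta_modular /shift_factor expr2 mulr0 !addr0 oppr0 expi0.
by rewrite mul1r add0r.
Qed.

Lemma theta4_modular mu : theta4 (mu - iC R) = theta3 mu.
Proof.
rewrite /theta4 theta_modular /shift_factor expr2 mulr0 !addr0 oppr0 expi0.
rewrite mul1r -mulrDl -[1 + 1]/(2%:R) divff ?pnatr_eq0 // -[1]add0r.
rewrite theta_period.
by rewrite mulr0 expi0 mul1r.
Qed.

(** * The coefficients of the metric at [mu - i] *)

Section Modular.
Variables (p q : C).
Let q' : C := q + p + 1 / 2.

Lemma w1_modular mu : w1 p q (mu - iC R) = w1 p q' mu.
Proof.
rewrite /w1 theta3_modular theta4_modular theta_modular dtheta_modular.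
rewrite -/q' (_ : q + 1 / 2 + p + 1 / 2 = q' + 1 / 2); last first.
  by rewrite /q'; ring.
rewrite [_ * (shift_factor p * _)]mulrCA -[_ / (_ * (_ * _))]mulf_div.
rewrite divff ?expi_neq0 // mul1r; congr (_ * _).
by rewrite -!mulrA; congr (_ * _); rewrite mulrC.
Qed.

Lemma w2_modular mu : w2 p q (mu - iC R) = w3 p q' mu.
Proof.
(* The multipliers of the numerator of [w2], with its constant [i], equal minus the factors [expi p]
   and [shift_factor p] of the denominator: the prefactor -1/2 of [w3] remains. *)
have k P : P = p + 1 / 2 ->
    iC R * expi (1 / 4) * (shift_factor P * expi (2 * P))
    = - (expi p * shift_factor p).
  move=> ->; rewrite -[in RHS]mulN1r -expi1 -expi_half /shift_factor -!expiD.
  by congr expi; field.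
have := mulf_neq0 (expi_neq0 p) (expi_neq0 (- (p ^+ 2 + p))).
rewrite /w2 /w3 theta2_modular theta4_modular theta_modular dtheta_modular -/q'.
(* The excess 1 is removed by periodicity, at the cost of [expi (2 * P)]. *)
rewrite (_ : q + 1 / 2 + (p + 1 / 2) + 1 / 2 = q' + 1); last first.
  by rewrite /q'; field.
rewrite dtheta_period -[cexp _]/(expi p) -/(shift_factor p).
move: (k _ erefl); set P := p + 1 / 2.
move: (dtheta _ _ _) (theta _ _ _) (theta2 _) (theta3 _) (expi p).
move: (shift_factor p) (shift_factor _) (expi (2 * _)) (expi _) (iC R).
move=> s s' h x i a b t2 t3 e {}k es0.
rewrite [s' * _]mulrA [e * _]mulrA -[X in _ * X = _]mulf_div.
transitivity (i * x * (s' * h) / (e * s) * (1 / 2 * t2 * t3 * (a / b))).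
  by ring.
by rewrite k mulNr divff //; ring.
Qed.

Lemma w3_modular mu : w3 p q (mu - iC R) = w2 p q' mu.
Proof.
(* Here the characteristic is exactly [q' + 1 / 2], so no period enters; the relation creates the
   [i] and the denominator [expi p] of [w2]. *)
have k P : P = p + 1 / 2 ->
    - expi (1 / 4) * shift_factor P * expi p = iC R * shift_factor p.
  move=> ->; rewrite !mulNr -mulN1r -expi1 -expi_half /shift_factor -!expiD.
  by congr expi; field.
have := expi_neq0 p; have := expi_neq0 (- (p ^+ 2 + p)).
rewrite /w2 /w3 theta2_modular theta3_modular theta_modular dtheta_modular -/q'.
rewrite (_ : q + (p + 1 / 2) + 1 / 2 = q' + 1 / 2); last by rewrite /q'; ring.
rewrite -[cexp _]/(expi p) -/(shift_factor p).
move: (k _ erefl); set P := p + 1 / 2.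
move: (dtheta _ _ _) (theta _ _ _) (theta2 _) (theta4 _) (expi p).
move: (shift_factor p) (shift_factor _) (expi _) (iC R).
move=> s s' x i a b t2 t4 e {}k s0 e0.
have {}k : - x * (s' / s) = i / e.
  by apply/eqP; rewrite mulrA eqr_div // k.
rewrite -mulf_div invfM.
transitivity (i / e * (1 / 2 * t2 * t4 * (a / b))); last by ring.
by rewrite -k; ring.
Qed.

Lemma F_modular Lambda mu : F Lambda p q (mu - iC R) = F Lambda p q' mu.
Proof.
by rewrite /F theta_modular dtheta_modular -mulf_div divff ?expi_neq0 // mul1r.
Qed.

(** The four functional identities hold at every [mu], so they pass to all derivatives; the exchange
    of [w2] and [w3] is precomposition with [flip4]. *)
Lemma family_jet_modular Lambda mu :
  family_jet Lambda p q (mu - iC R) =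
  family_jet Lambda p q' mu \o HeatCoefficientSymmetry.flip4.
Proof.
apply/funext => a; apply/funext => k; rewrite /family_jet /= -derive1n_shift.
rewrite [val (HeatCoefficientSymmetry.flip4 a)]HeatCoefficientSymmetry.flip4E.
apply: eq_derive1n => x.
case: a => -[|[|[|[|a]]]] a4; last by [].
- exact: F_modular.
- exact: w1_modular.
- exact: w2_modular.
- exact: w3_modular.
Qed.

End Modular.
End Shifts.

Theorem theorem6p1 (R : realType) (Lambda p q mu : R[i])
  (Lambda_neq0 : Lambda != 0) (mu_gt0 : 0 < complex.Re mu)
  (theta_neq0 : theta p q (mu - iC R) != 0)
  (dtheta_neq0 : dtheta p q (mu - iC R) != 0) :
  tilde_a0 Lambda p q (mu - iC R) = tilde_a0 Lambda p (q + p + 1 / 2) mu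
  /\ (w1 p q (mu - iC R) != 0 -> w2 p q (mu - iC R) != 0 ->
      w3 p q (mu - iC R) != 0 ->
      tilde_a2 Lambda p q (mu - iC R) = tilde_a2 Lambda p (q + p + 1 / 2) mu
      /\ tilde_a4 Lambda p q (mu - iC R)
         = tilde_a4 Lambda p (q + p + 1 / 2) mu).
Proof.
rewrite /tilde_a0 /tilde_a2 /tilde_a4 /a4 family_jet_modular.
split; first exact: HeatCoefficientSymmetry.a0_flip.
by split; [exact: HeatCoefficientSymmetry.a2_flip|
  exact: HeatCoefficientSymmetry.heat_coefficient_flip].
Qed.
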